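(* (Local Lidskii's theorem) Let $S$ be a positive semidefinite $d\times d$ complex matrix and let $\mu=(\mu_i)_{i\in\mathbb I_d}$ with $\mu_1\ge\cdots\ge\mu_d\ge0$. Let $\varphi:[0,\infty)\to[0,\infty)$ be strictly convex, and let $G_0\in\mathcal O_\mu$ be a local minimizer on $\mathcal O_\mu$ of the function $\Phi:\mathcal O_\mu\to[0,\infty)$, $\Phi(G)=\operatorname{tr}(\varphi(S+G))$. Then there exists an orthonormal basis $\{v_i\}_{i\in\mathbb I_d}$ of $\mathbb C^d$ such that, writing $(\lambda_i)_{i\in\mathbb I_d}=\lambda^\uparrow(S)$, $$S=\sum_{i\in\mathbb I_d}\lambda_i\, v_i\otimes v_i\quad\text{and}\quad G_0=\sum_{i\in\mathbb I_d}\mu_i\, v_i\otimes v_i .$$ In particular, $\lambda(S+G_0)=\big(\lambda^\uparrow(S)+\lambda^\downarrow(G_0)\big)^\downarrow$, so $G_0$ is also a global minimizer of $\Phi$ on $\mathcal O_\mu$.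
   Context: $\mathbb I_d=\{1,\dots,d\}$. For a selfadjoint matrix $A$, $\lambda(A)=\lambda^\downarrow(A)$ (respectively $\lambda^\uparrow(A)$) is the vector of eigenvalues of $A$, counted with multiplicity, in non-increasing (respectively non-decreasing) order; for $x\in\mathbb R^d$, $x^\downarrow$ is its non-increasing rearrangement. $x\otimes y$ is the matrix with $(x\otimes y)z=\langle z,y\rangle x$. $\mathcal O_\mu=\{G \text{ positive semidefinite } d\times d:\ \lambda(G)=\mu\}=\{U^*D_\mu U: U \text{ unitary}\}$, where $D_\mu$ is the diagonal matrix with main diagonal $\mu$; $\mathcal O_\mu$ is endowed with the metric induced by the operator norm. $\varphi(A)$ is defined by functional calculus, so $\operatorname{tr}\varphi(A)=\sum_{i}\varphi(\lambda_i(A))$. *)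

(* Defs.v *)
From mathcomp Require Import all_boot all_order all_algebra.
From mathcomp Require Import complex.
From mathcomp Require Import boolp classical_sets reals.

Set Implicit Arguments.
Unset Strict Implicit.
Unset Printing Implicit Defensive.

Import Order.TTheory GRing.Theory Num.Theory.

Local Open Scope classical_set_scope.
Local Open Scope ring_scope.
Local Open Scope complex_scope.
Local Open Scope sesquilinear_scope.

Section Defs.
Variables (R : realType) (d : nat).
Implicit Types (A S G : 'M[R[i]]_d) (x y : 'cV[R[i]]_d) (mu : 'rV[R]_d).

(* Linear in the first argument, conjugate-linear in the second. *)
Definition inner x y : R[i] := (y ^t* *m x) 0 0.

Definition l2norm x : R := Num.sqrt (complex.Re (inner x x)).

Definition opnorm A : R :=
  sup [set l2norm (A *m x) | x in [set x | l2norm x <= 1]].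

Definition outer x y : 'M[R[i]]_d := x *m y ^t*.

Definition orthonormal_basis (v : 'I_d -> 'cV[R[i]]_d) : Prop :=
  basis_of fullv [tuple v i | i < d] /\
  forall i j, inner (v i) (v j) = (i == j)%:R.

(* On [R[i]], [0 <= z] means that [z] is a nonnegative real. *)
Definition psdmx A : Prop :=
  A \is hermsymmx /\ forall x, 0 <= inner (A *m x) x.

(* The eigenvalues, as the roots of the characteristic polynomial repeated
   according to their multiplicity, in an unspecified order.  *)
Definition eigs A : seq R[i] :=
  sval (closed_field_poly_normal (char_poly A)).

(* For selfadjoint [A], [eigs A] has size [d] and its entries are real, so that
   taking real parts loses nothing and the default of [nth] is never used. *)
Definition lambda_down A : 'rV[R]_d :=
  \row_i (sort >=%R [seq complex.Re z | z <- eigs A])`_i.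

Definition lambda_up A : 'rV[R]_d :=
  \row_i (sort <=%R [seq complex.Re z | z <- eigs A])`_i.

Definition rearr_down (u : 'rV[R]_d) : 'rV[R]_d :=
  \row_i (sort >=%R [seq u 0 j | j <- enum 'I_d])`_i.

Definition orbit_mu mu : set 'M[R[i]]_d :=
  [set G | psdmx G /\ lambda_down G = mu].

(* Functional calculus for selfadjoint [A], through its unitary diagonalization
   [A = invmx (spectralmx A) *m diag_mx (spectral_diag A) *m spectralmx A]. *)
Definition fun_calc (phi : R -> R) A : 'M[R[i]]_d :=
  invmx (spectralmx A) *m
    diag_mx (map_mx (fun z => (phi (complex.Re z))%:C) (spectral_diag A)) *m
  spectralmx A.

Definition Phi (phi : R -> R) S G : R := complex.Re (\tr (fun_calc phi (S + G))).

Definition local_minimizer_on (O : set 'M[R[i]]_d) (F : 'M[R[i]]_d -> R) G0 :=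
  O G0 /\
  exists2 e : R, 0 < e &
    forall G, O G -> opnorm (G - G0) < e -> F G0 <= F G.

Definition global_minimizer_on (O : set 'M[R[i]]_d) (F : 'M[R[i]]_d -> R) G0 :=
  O G0 /\ forall G, O G -> F G0 <= F G.

End Defs.

(* [phi] is a function on [0, +oo[ extended arbitrarily to the negative reals;
   only its values on [0, +oo[ matter. *)
Definition strictly_convex_nneg (R : realType) (phi : R -> R) : Prop :=
  forall x y t : R, 0 <= x -> 0 <= y -> x != y -> 0 < t -> t < 1 ->
    phi (t * x + (1 - t) * y) < t * phi x + (1 - t) * phi y.

(* Main.v *)
Require Import Defs.
From mathcomp Require Import all_boot all_order all_algebra all_fingroup.
From mathcomp Require Import complex.
From mathcomp Require Import boolp classical_sets reals.
From mathcomp Require Import ring lra zify.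

(** Write [A = S + G0]. Everything about the local minimizer comes from one
    identity. Let [0 < k < 1] and let [W] be a unitary commuting with
    [M = (1 - k) S - k G0]. Since [S = k A + M] and [(1 - k) A = M + G0],
[[
      S + W G0 W^* = k A + (1 - k) W A W^*,
]]
    so rotating [G0] by [W] replaces [A] by a proper convex combination of two
    matrices with the same spectrum. By strict convexity of the trace functional
    ([strict_trace_convexity]) this strictly decreases [Phi] unless [W] commutes
    with [A]. If [H] is selfadjoint and commutes with [M], then Cayley transforms
    of [i t H] with small [t > 0] are such unitaries [W], as near to the identity
    as desired ([cayley_near]). Hence, at a local minimizer, every selfadjoint
    matrix commuting with [M] commutes with [A] ([local_min_comm]).

    Two choices of [k] and [H] finish the description of the minimizer
    ([local_min_codiagonal]). With [k = 1/2] and [H = S - G0], the conclusion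
    says that [S] and [G0] commute, hence have a common orthonormal eigenbasis,
    with eigenvalues [s_i] and [g_i]. If [s_i < s_j] and [g_i < g_j] for some
    [i] and [j], choose [k] making the eigenvalues [(1 - k) s - k g] at [i] and
    [j] equal, and let [H] exchange the two eigenvectors: then
    [s_i + g_i = s_j + g_j], which is absurd. So the two spectra are oppositely
    ordered and the basis can be sorted. No differentiability of [phi] is used,
    and [phi] may be discontinuous at [0].

    Global minimality is then Lidskii's inequality: the eigenvalues of [S + G]
    majorize [lambda_up S + lambda_down G]. It is proved with the hinge
    functions [x |-> max (x - c) 0]: if [D] is the positive part of [S + G - c],
    then [- S <= D - S] and [G - c <= D - S], so Weyl's monotonicity bounds
    eigenvalue by eigenvalue both [- lambda_up S] and [lambda_down G - c] by the
    spectrum of [D - S]; summing gives the hinge inequality ([lidskii_hinge]).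
    Karamata's inequality converts it into the inequality for [phi]. *)

(** * Convex functions on the half-line *)

Section Convex.
Import Order.TTheory GRing.Theory Num.Theory.
Local Open Scope ring_scope.
Set Implicit Arguments.
Unset Strict Implicit.
Unset Printing Implicit Defensive.

Variable R : realType.
Implicit Types (phi : R -> R).

Lemma ge_transitive : transitive (>=%R : rel R).
Proof. by move=> x y z /= h1 h2; apply: le_trans h1. Qed.

Lemma ge_antisymmetric : antisymmetric (>=%R : rel R).
Proof. by move=> x y /=; rewrite andbC => /le_anti. Qed.

Lemma three_chords phi (x m y : R) : strictly_convex_nneg phi ->
  0 <= x -> x < m -> m < y ->
  (phi m - phi x) / (m - x) <= (phi y - phi m) / (y - m).
Proof.
move=> cvx x0 xm my.
have yx : 0 < y - x by lra.
have mx : 0 < m - x by lra.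
have ym : 0 < y - m by lra.
have neq : x != y by rewrite lt_eqF //; lra.
have t0 : 0 < (y - m) / (y - x) by rewrite divr_gt0.
have t1 : (y - m) / (y - x) < 1 by rewrite ltr_pdivrMr // mul1r; lra.
have := cvx x y _ x0 (ltac:(lra) : 0 <= y) neq t0 t1.
have -> : (y - m) / (y - x) * x + (1 - (y - m) / (y - x)) * y = m.
  by field; rewrite gt_eqF.
have -> : 1 - (y - m) / (y - x) = (m - x) / (y - x) by field; rewrite gt_eqF.
rewrite ![_ / (y - x) * _]mulrAC -mulrDl ltr_pdivlMr // => H.
rewrite ler_pdivrMr // mulrAC ler_pdivlMr //.
nra.
Qed.

(** The line lies strictly below the graph off [m], which is what yields the
    equality cases below. Its slope is the supremum of the left chord slopes;
    the hypothesis [0 < m] is needed because at the endpoint [0] there may be no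
    supporting line (infinite slope or a jump). *)
Lemma supporting_line phi (m : R) : strictly_convex_nneg phi -> 0 < m ->
  exists b, forall x, 0 <= x -> phi m + b * (x - m) <= phi x ?= iff (x == m).
Proof.
move=> cvx m0.
pose E := [set (phi m - phi x) / (m - x) | x in [set x | 0 <= x < m]]%classic.
have E0 : (E !=set0)%classic.
  by exists ((phi m - phi 0) / (m - 0)); exists 0 => //=; rewrite lexx.
have Eub y : m < y -> ubound E ((phi y - phi m) / (y - m)).
  by move=> my _ [x /= /andP[x0 xm] <-]; apply: three_chords.
have hE : has_sup E by split => //; exists ((phi (m + 1) - phi m) / (m + 1 - m)); apply: Eub; lra.
exists (sup E) => x x0.
have le z : 0 <= z -> phi m + sup E * (z - m) <= phi z.
  move=> z0; case: (ltgtP z m) => [zm|mz|->].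
  - have : (phi m - phi z) / (m - z) <= sup E.
      by apply: sup_upper_bound => //; exists z => //=; rewrite z0.
    rewrite ler_pdivrMr; last by lra. lra.
  - have : sup E <= (phi z - phi m) / (z - m).
      by apply: ge_sup => //; apply: Eub.
    rewrite ler_pdivlMr; last by lra. lra.
  - by rewrite subrr mulr0 addr0.
split; first exact: le.
case: (eqVneq x m) => [->|xm]; first by rewrite subrr mulr0 addr0 eqxx.
(* a point of contact other than [m] would, by strict convexity at its midpoint
   with [m], put the graph below the line there *)
apply/negbTE; apply/eqP => eqx.
have h0 : 0 < 2^-1 :> R by lra.
have h1 : 2^-1 < 1 :> R by lra.
have := cvx x m 2^-1 x0 (ltW m0) xm h0 h1.
have hz : 0 <= 2^-1 * x + (1 - 2^-1) * m by lra.
have := le _ hz.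
lra.
Qed.

(** Averaging the supporting line at the barycentre [m]. At [m = 0] there is no
    supporting line, but then every point carrying weight is [0]. *)
Lemma jensen (I : finType) phi (p a : I -> R) (m : R) :
  strictly_convex_nneg phi ->
  (forall j, 0 <= p j) -> \sum_j p j = 1 -> (forall j, 0 <= a j) ->
  m = \sum_j p j * a j ->
  phi m <= \sum_j p j * phi (a j) ?= iff [forall j, (p j != 0) ==> (a j == m)].
Proof.
move=> cvx p0 p1 a0 em.
have m0 : 0 <= m by rewrite em sumr_ge0 // => j _; rewrite mulr_ge0.
have [mz|mn0] := eqVneq m 0.
  have am j : p j != 0 -> a j = m.
    move=> pj; have /eqP := em; rewrite mz eq_sym psumr_eq0 => [/allP|i _]; last exact: mulr_ge0.
    move=> /(_ j); rewrite mem_index_enum mulf_eq0 (negbTE pj) => /(_ isT) /eqP //.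
  have -> : [forall j, (p j != 0) ==> (a j == m)].
    by apply/forallP => j; apply/implyP => /am ->.
  rewrite (eq_bigr (fun j => p j * phi m)) => [|j _].
    by rewrite -mulr_suml p1 mul1r; split; rewrite ?lexx ?eqxx.
  by have [->|/am ->//] := eqVneq (p j) 0; rewrite !mul0r.
have [b hb] : exists b, forall x, 0 <= x -> phi m + b * (x - m) <= phi x ?= iff (x == m).
  by apply: supporting_line => //; rewrite lt_def mn0.
have -> : phi m = \sum_j p j * (phi m + b * (a j - m)).
  under eq_bigr do rewrite mulrDr mulrCA mulrBr.
  rewrite big_split /= -mulr_suml p1 mul1r -mulr_sumr sumrB -em -mulr_suml p1.
  by rewrite mul1r subrr mulr0 addr0.
have -> : [forall j, (p j != 0) ==> (a j == m)] =
          [forall (j | true), (p j == 0) || (a j == m)].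
  by apply: eq_forallb => j; rewrite implyNb.
apply: leif_sum => j _.
have [->|pj] := eqVneq (p j) 0; first by rewrite !mul0r; split; rewrite ?eqxx.
have pj0 : 0 < p j by rewrite lt_def pj p0.
have [h1 h2] := hb _ (a0 j).
by split; [rewrite ler_wpM2l | rewrite (inj_eq (mulfI pj)) h2].
Qed.

(** Rows of [T] give Jensen's inequality, columns make the right-hand sides add
    up to the sum of [phi] over [a]; equality of the totals forces equality in
    every row. *)
Lemma doubly_stochastic_eq (I : finType) phi (T : I -> I -> R) (a k : I -> R) :
  strictly_convex_nneg phi ->
  (forall i j, 0 <= T i j) -> (forall i, \sum_j T i j = 1) ->
  (forall j, \sum_i T i j = 1) -> (forall j, 0 <= a j) ->
  (forall i, k i = \sum_j T i j * a j) ->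
  \sum_j phi (a j) <= \sum_i phi (k i) ->
  forall i j, T i j != 0 -> a j = k i.
Proof.
move=> cvx T0 Tr Tc a0 ek le i j Tij.
have J i' := jensen cvx (T0 i') (Tr i') a0 (ek i').
have := @leif_sum R I xpredT _ _ _ (fun i' _ => J i').
have -> : \sum_i0 \sum_j0 T i0 j0 * phi (a j0) = \sum_j phi (a j).
  by rewrite exchange_big; apply: eq_bigr => j' _; rewrite -mulr_suml Tc mul1r.
move=> /ge_leif; rewrite le => /esym /forallP /(_ i) /forallP /(_ j).
by rewrite Tij => /eqP.
Qed.

Lemma abel_sum_ge (b dl : nat -> R) n :
  (forall i j, (i <= j <= n)%N -> b j <= b i) ->
  (forall k, (k <= n)%N -> 0 <= \sum_(0 <= i < k.+1) dl i) ->
  b n * \sum_(0 <= i < n.+1) dl i <= \sum_(0 <= i < n.+1) b i * dl i.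
Proof.
elim: n => [|n IH] bd pos; first by rewrite !big_nat1.
rewrite big_nat_recr //= [leRHS]big_nat_recr //= mulrDr lerD2r.
apply: le_trans (IH _ _).
- by rewrite ler_wpM2r ?pos // bd // leqnSn leqnn.
- by move=> i j /andP[ij jn]; rewrite bd // ij ltnW.
- by move=> k kn; rewrite pos // ltnW.
Qed.

(** With threshold [c = y k], the hinge is exact on the [k] largest entries of [y]
    and vanishes on the others. *)
Lemma hinge_partial_sums (n : nat) (x y : nat -> R) :
  (forall i j, (i <= j)%N -> (j < n)%N -> y j <= y i) ->
  (forall c, \sum_(0 <= i < n) Num.max (x i - c) 0 <=
             \sum_(0 <= i < n) Num.max (y i - c) 0) ->
  forall k, (k < n)%N -> \sum_(0 <= i < k) x i <= \sum_(0 <= i < k) y i.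
Proof.
move=> ys hinge k kn; have kn' := ltnW kn.
have := hinge (y k).
rewrite [leRHS](big_cat_nat (n := k)) //= [X in _ + X]big_nat_cond [X in _ + X]big1 ?addr0; last first.
  by move=> i /andP[/andP[ki iN] _]; apply/max_idPr; rewrite subr_le0 ys.
rewrite [leLHS](big_cat_nat (n := k)) //= => H.
rewrite -subr_ge0 -sumrB.
have -> : \sum_(0 <= i < k) (y i - x i) =
  \sum_(0 <= i < k) (y i - y k) - \sum_(0 <= i < k) (x i - y k).
  by rewrite -sumrB; apply: eq_bigr => i _; lra.
rewrite subr_ge0.
have -> : \sum_(0 <= i < k) (y i - y k) = \sum_(0 <= i < k) Num.max (y i - y k) 0.
  apply: eq_big_nat => i /andP[_ ik]; apply/esym/max_idPl.
  by rewrite subr_ge0 ys // ltnW.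
apply: le_trans H; apply: le_trans (_ : \sum_(0 <= i < k) Num.max (x i - y k) 0 <= _).
  by apply: ler_sum => i _; rewrite le_max lexx.
by rewrite lerDl sumr_ge0 // => i _; rewrite le_max lexx orbT.
Qed.

(** Where [x i > 0], supporting lines at [x i] bound the increments of [phi] below
    by slopes that decrease with [i], and Abel summation against the nonnegative
    partial sums of [y - x] concludes. There need not be a supporting line at
    [0], but where [x] vanishes so does [y]: the partial sums before that point
    already exhaust the common total. *)
Lemma karamata_sorted phi (n : nat) (x y : nat -> R) :
  strictly_convex_nneg phi ->
  (forall i, 0 <= x i) -> (forall i, 0 <= y i) ->
  (forall i j, (i <= j)%N -> (j < n)%N -> x j <= x i) ->
  (forall i j, (i <= j)%N -> (j < n)%N -> y j <= y i) ->
  \sum_(0 <= i < n) x i = \sum_(0 <= i < n) y i ->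
  (forall c, \sum_(0 <= i < n) Num.max (x i - c) 0 <=
             \sum_(0 <= i < n) Num.max (y i - c) 0) ->
  \sum_(0 <= i < n) phi (x i) <= \sum_(0 <= i < n) phi (y i).
Proof.
move=> cvx x0 y0 xs ys exy hinge.
have part k : (k <= n)%N -> \sum_(0 <= i < k) x i <= \sum_(0 <= i < k) y i.
  rewrite leq_eqVlt => /predU1P[->|]; first by rewrite exy.
  exact: hinge_partial_sums hinge k.
have [b hb] : exists b : R -> R, forall m : R, 0 < m -> forall z : R, 0 <= z ->
    phi m + b m * (z - m) <= phi z.
  have /choice[b hb] : forall m : R, exists c, 0 < m -> forall z : R, 0 <= z ->
      phi m + c * (z - m) <= phi z.
    move=> m; case: (ltP 0 m) => m0; last by exists 0.
    by have [c hc] := supporting_line cvx m0; exists c => _ z /hc[].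
  by exists b.
(* [r] is the index at which the zeros of [x] begin *)
have [r rn hr] : exists2 r, (r <= n)%N & (forall i, (i < r)%N -> 0 < x i) /\
     (forall i, (r <= i < n)%N -> x i = 0).
  exists (find (fun i => x i == 0) (iota 0 n)).
    by rewrite -[leqRHS](size_iota 0) find_size.
  split=> i.
    move=> ir; rewrite lt_def x0 andbT; have := before_find 0%N ir.
    rewrite nth_iota ?add0n => [->//|].
    by apply: leq_trans ir _; rewrite -[leqRHS](size_iota 0) find_size.
  move=> /andP[ri iN]; apply/eqP; rewrite eq_le x0 andbT.
  have hs : has (fun i => x i == 0) (iota 0 n).
    by rewrite has_find size_iota (leq_ltn_trans ri).
  have /eqP := nth_find 0%N hs; rewrite nth_iota ?add0n => [<-|]; first exact: xs.
  by rewrite (leq_ltn_trans ri).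
have xr : \sum_(0 <= i < r) x i = \sum_(0 <= i < n) x i.
  rewrite [RHS](big_cat_nat (n := r)) //= [X in _ + X]big_nat_cond.
  by rewrite [X in _ + X]big1 ?addr0 // => i /andP[/hr.2].
have yz : \sum_(r <= i < n) y i = 0.
  apply/le_anti; rewrite sumr_ge0 // andbT.
  by have := part r rn; rewrite xr exy (big_cat_nat (n := r)) //= gerDl.
have yr i : (r <= i < n)%N -> y i = 0.
  move=> irn; have /eqP := yz; rewrite psumr_eq0 // => /allP /(_ i).
  by rewrite mem_index_iota => /(_ irn) /eqP.
rewrite (big_cat_nat (n := r)) //= [leRHS](big_cat_nat _ (n := r)) //=.
have -> : \sum_(r <= i < n) phi (x i) = \sum_(r <= i < n) phi (y i).
  by apply: eq_big_nat => i irn; rewrite hr.2 // yr.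
rewrite lerD2r; case: r rn xr yz yr hr => [|r] rn xr yz yr hr; first by rewrite !big_nil.
rewrite -subr_ge0 -sumrB.
have : \sum_(0 <= i < r.+1) b (x i) * (y i - x i) <=
       \sum_(0 <= i < r.+1) (phi (y i) - phi (x i)).
  apply: ler_sum_nat => i /andP[_ ir]; rewrite lerBrDl.
  by apply: hb => //; apply: hr.1.
apply: le_trans.
apply: le_trans (abel_sum_ge (b := fun i => b (x i)) _ _).
- by rewrite sumrB mulrBr subr_ge0 xr exy [X in _ * X](big_cat_nat (n := r.+1)) //= yz addr0.
- move=> i j /andP[ij jr]; have xij : x j <= x i by apply: xs => //; apply: leq_ltn_trans rn.
  have h1 := hb _ (hr.1 i (leq_trans ij jr)) _ (x0 j).
  have h2 := hb _ (hr.1 j jr) _ (x0 i).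
  (* adding the support inequalities at [x i] and [x j] makes the slope monotone *)
  case: (ltgtP (x i) (x j)) xij => // [xji _|-> //].
  rewrite -(@ler_pM2r _ (x i - x j)) ?subr_gt0 //; lra.
- move=> k kr; rewrite sumrB subr_ge0; apply: part; lia.
Qed.

(** Karamata's inequality. Majorization enters in hinge form: the functions
    [t |-> max (t - c) 0] are the extremal convex ones, so testing them against
    equal totals is as strong as comparing partial sums of the sorted lists. *)
Lemma karamata phi (xs ys : seq R) :
  strictly_convex_nneg phi -> size xs = size ys ->
  {in xs, forall x, 0 <= x} -> {in ys, forall y, 0 <= y} ->
  \sum_(x <- xs) x = \sum_(y <- ys) y ->
  (forall c, \sum_(x <- xs) Num.max (x - c) 0 <=
             \sum_(y <- ys) Num.max (y - c) 0) ->
  \sum_(x <- xs) phi x <= \sum_(y <- ys) phi y.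
Proof.
move=> cvx sz x0 y0 exy hinge.
have sumE (F : R -> R) (s : seq R) : \sum_(z <- s) F z =
    \sum_(0 <= i < size s) F (nth 0 (sort >=%R s) i).
  by rewrite -(size_sort >=%R s) -(big_nth 0 xpredT F) (perm_big _ (permEl (perm_sort _ _))).
have nth0 (s : seq R) : {in s, forall z, 0 <= z} ->
    forall i, 0 <= nth 0 (sort >=%R s) i.
  move=> s0 i; have [si|si] := ltnP i (size (sort >=%R s)); last by rewrite nth_default.
  by apply: s0; rewrite -(mem_sort >=%R) mem_nth.
have noninc (s : seq R) i j : (i <= j)%N -> (j < size s)%N ->
    nth 0 (sort >=%R s) j <= nth 0 (sort >=%R s) i.
  move=> ij js.
  have rf : reflexive (>=%R : rel R) by move=> a /=.
  apply: (sorted_leq_nth ge_transitive rf 0 (sort_sorted (@ge_total _ R) s)) => //.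
  - by rewrite inE size_sort (leq_ltn_trans ij).
  - by rewrite inE size_sort.
rewrite !sumE sz; apply: karamata_sorted => //; try exact: nth0.
- by rewrite -sz; apply: noninc.
- exact: noninc.
- by rewrite -{1}sz -!(sumE id).
- by move=> c; rewrite -{1}sz -!(sumE (fun z => Num.max (z - c) 0)).
Qed.

End Convex.

Section HermitianMatrices.
Import Order.TTheory GRing.Theory Num.Theory.
Local Open Scope ring_scope.
Local Open Scope complex_scope.
Local Open Scope sesquilinear_scope.
Set Implicit Arguments.
Unset Strict Implicit.
Unset Printing Implicit Defensive.

Variable R : realType.

(** * Unitary diagonalization of selfadjoint matrices *)

Lemma trmxCM m n p (A : 'M[R[i]]_(m, n)) (B : 'M[R[i]]_(n, p)) :
  (A *m B)^t* = B^t* *m A^t*.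
Proof. by rewrite trmx_mul map_mxM. Qed.

Lemma trmxCD m n (A B : 'M[R[i]]_(m, n)) : (A + B)^t* = A^t* + B^t*.
Proof. by rewrite linearD map_mxD. Qed.

Lemma trmxCN m n (A : 'M[R[i]]_(m, n)) : (- A)^t* = - A^t*.
Proof. by rewrite linearN map_mxN. Qed.

Lemma trmxCZ m n c (A : 'M[R[i]]_(m, n)) : (c *: A)^t* = c^* *: A^t*.
Proof. by rewrite linearZ map_mxZ. Qed.

Lemma trmxC1 n : (1%:M : 'M[R[i]]_n)^t* = 1%:M.
Proof. by rewrite trmx1 map_mx1. Qed.

Variable d : nat.
Implicit Types (A B S G H P Q U W X : 'M[R[i]]_d) (a b s g : 'rV[R]_d).

Lemma selfadjP A : reflect (A^t* = A) (A \is hermsymmx).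
Proof.
by rewrite is_hermitianmxE expr0 scale1r eq_sym; apply: eqP.
Qed.

Lemma trmxC_unitarymx P : P \is unitarymx -> P^t* \is unitarymx.
Proof. by rewrite trmxC_unitary. Qed.

Lemma unitarymx_trmxCl P : P \is unitarymx -> P^t* *m P = 1%:M.
Proof. by move=> uP; apply/mulmx1C/unitarymxP. Qed.

(** Eigenvalues are kept as real vectors, so that they can be ordered. *)
Definition real_diag a : 'M[R[i]]_d := diag_mx (map_mx (real_complex R) a).

Lemma real_diagE a i j : real_diag a i j = (a 0 i)%:C *+ (i == j).
Proof. by rewrite !mxE. Qed.

Lemma trmxC_real_diag a : (real_diag a)^t* = real_diag a.
Proof.
apply/matrixP => i j; rewrite !mxE eq_sym.
by case: eqP => [->|_]; rewrite ?mulr1n ?mulr0n ?rmorph0 //; apply/eqP; rewrite eq_complex /= oppr0 !eqxx.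
Qed.

(** The rows of [P] are the adjoints of an orthonormal eigenbasis of [A]. *)
Definition diagonalizes P a A := P \is unitarymx /\ A = P^t* *m real_diag a *m P.

Lemma spectral_diagonalizes A : A^t* = A ->
  diagonalizes (spectralmx A) (map_mx (@complex.Re R) (spectral_diag A)) A.
Proof.
move=> hA; have sA : A \is hermsymmx by apply/selfadjP.
split; first exact: spectral_unitarymx.
have -> : real_diag (map_mx (@complex.Re R) (spectral_diag A)) = diag_mx (spectral_diag A).
  congr diag_mx; apply/rowP => j; rewrite !mxE RRe_real //.
  by have /mxOverP := hermitian_spectral_diag_real sA; apply.
rewrite -invmx_unitary ?spectral_unitarymx //.
exact/orthomx_spectralP/hermitian_normalmx.
Qed.

Lemma selfadj_diag A : A^t* = A -> exists P a, diagonalizes P a A.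
Proof. move=> /spectral_diagonalizes hA; exists (spectralmx A); eexists; exact: hA. Qed.

Lemma diagonalizes_selfadj P a A : diagonalizes P a A -> A^t* = A.
Proof. by case=> _ ->; rewrite !trmxCM trmxC_real_diag trmxCK mulmxA. Qed.

Lemma diagonalizes_conj P a A : diagonalizes P a A -> P *m A = real_diag a *m P.
Proof. by case=> uP ->; rewrite !mulmxA (unitarymxP uP) mul1mx. Qed.

Lemma char_poly_diagonalizes P a A : diagonalizes P a A ->
  char_poly A = \prod_(i < d) ('X - ((a 0 i)%:C)%:P).
Proof.
case=> uP ->.
have -> : char_poly (P^t* *m real_diag a *m P) = char_poly (real_diag a).
  rewrite /char_poly /char_poly_mx.
  have e : 'X%:M = map_mx polyC (P^t*) *m 'X%:M *m map_mx polyC P :> 'M[{poly R[i]}]_d.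
    rewrite mul_mx_scalar -scalemxAl -map_mxM (unitarymx_trmxCl uP).
    by rewrite map_mx1 scalemx1.
  rewrite [X in \det (X - _)]e !map_mxM /= -mulmxBl -mulmxBr !det_mulmx.
  rewrite mulrC mulrA -det_mulmx -map_mxM (unitarymxP uP) map_mx1.
  by rewrite det1 mul1r.
rewrite char_poly_trig ?diag_mx_is_trig //.
by apply: eq_bigr => i _; rewrite real_diagE eqxx.
Qed.

(** Links the roots of the characteristic polynomial with any diagonalization, so
    that spectra can be read from whichever eigenbasis is convenient. *)
Lemma eigs_perm P a A : diagonalizes P a A ->
  perm_eq (eigs A) [seq (a 0 i)%:C | i <- enum 'I_d].
Proof.
move=> hA; rewrite /eigs; case: closed_field_poly_normal => r /= er.
apply: prod_XsubC_eq; rewrite big_map big_enum /= -(char_poly_diagonalizes hA).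
by rewrite [RHS]er (monicP (char_poly_monic A)) scale1r.
Qed.

Lemma Re_eigs_perm P a A : diagonalizes P a A ->
  perm_eq [seq complex.Re z | z <- eigs A] [seq a 0 i | i <- enum 'I_d].
Proof.
move=> /eigs_perm /(perm_map (@complex.Re R)).
by rewrite -map_comp.
Qed.

Lemma real_diagD a b : real_diag (a + b) = real_diag a + real_diag b.
Proof. by rewrite /real_diag map_mxD raddfD. Qed.

Lemma real_diagZ (c : R) a : real_diag (c *: a) = c%:C *: real_diag a.
Proof. by rewrite /real_diag map_mxZ linearZ. Qed.

Lemma diagonalizesD P a A b B : diagonalizes P a A -> diagonalizes P b B ->
  diagonalizes P (a + b) (A + B).
Proof. by case=> uP -> [_ ->]; split; rewrite // real_diagD mulmxDr mulmxDl. Qed.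

Lemma diagonalizesZ (c : R) P a A : diagonalizes P a A ->
  diagonalizes P (c *: a) (c%:C *: A).
Proof. by case=> uP ->; split; rewrite // real_diagZ -scalemxAr -scalemxAl. Qed.

Lemma diagonalizesN P a A : diagonalizes P a A -> diagonalizes P (- a) (- A).
Proof.
by move=> /(diagonalizesZ (-1)); rewrite rmorphN1 !scaleN1r.
Qed.

Lemma diagonalizes_scalar P (c : R) : P \is unitarymx ->
  diagonalizes P (const_mx c) (c%:C)%:M.
Proof.
move=> uP; split=> //; rewrite /real_diag map_const_mx diag_const_mx.
by rewrite mul_mx_scalar -scalemxAl (unitarymx_trmxCl uP) scalemx1.
Qed.

Lemma trace_diagonalizes P a A : diagonalizes P a A -> \tr A = (\sum_i a 0 i)%:C.
Proof.
case=> uP ->; rewrite mxtrace_mulC mulmxA (unitarymxP uP) mul1mx mxtrace_diag rmorph_sum.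
by apply: eq_bigr => i _; rewrite mxE.
Qed.

Lemma diagonalizes_unitary_conj P a A W : W \is unitarymx ->
  diagonalizes P a A -> diagonalizes (P *m W^t*) a (W *m A *m W^t*).
Proof.
move=> uW [uP ->]; split; first exact: mul_unitarymx uP (trmxC_unitarymx uW).
by rewrite trmxCM trmxCK !mulmxA.
Qed.

Lemma similar_trig_diagonalizes P A : P \is unitarymx -> A^t* = A ->
  similar_trig P A -> exists a, diagonalizes P a A.
Proof.
move=> uP sA /is_trig_mxP; rewrite conjymx // => tr.
set D := P *m A *m P^t* in tr.
have sD : D^t* = D by rewrite /D !trmxCM trmxCK sA mulmxA.
have sDE i j : D i j = (D j i)^* by rewrite -{1}sD !mxE.
exists (\row_i complex.Re (D i i)); split=> //.
have -> : real_diag (\row_i complex.Re (D i i)) = D.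
  apply/matrixP => i j; rewrite real_diagE mxE.
  case: (ltngtP i j) => [ij|ji|/val_inj ij].
  - have -> : (i == j) = false by apply/eqP => e; rewrite e ltnn in ij.
    by rewrite (tr i j ij).
  - have -> : (i == j) = false by apply/eqP => e; rewrite e ltnn in ji.
    by rewrite [RHS]sDE (tr j i ji) rmorph0.
  - by rewrite -ij eqxx mulr1n RRe_real //; apply/CrealP; exact: (esym (sDE i i)).
by rewrite /D !mulmxA (unitarymx_trmxCl uP) mul1mx -mulmxA (unitarymx_trmxCl uP) mulmx1.
Qed.

(** A simultaneous unitary triangularization of commuting selfadjoint matrices is
    already diagonal. *)
Lemma codiagonalization A B : A^t* = A -> B^t* = B -> A *m B = B *m A ->
  exists P a b, diagonalizes P a A /\ diagonalizes P b B.
Proof.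
move=> sA sB /cotrigonalization2 [P uP /andP[tA tB]].
have [a ha] := similar_trig_diagonalizes uP sA tA.
have [b hb] := similar_trig_diagonalizes uP sB tB.
by exists P, a, b.
Qed.

Lemma orthonormal_basis_rows P : P \is unitarymx ->
  orthonormal_basis (fun i => (row i P)^t*).
Proof.
move=> uP.
have on i j : inner ((row i P)^t*) ((row j P)^t*) = (i == j)%:R.
  rewrite /inner trmxCK; have /matrixP /(_ j i) := unitarymxP uP.
  rewrite [RHS]mxE eq_sym => <-; rewrite !mxE.
  by apply: eq_bigr => k _; rewrite !mxE.
split=> //; rewrite basisEfree subvf size_tuple dimvf dim_matrix [(d * 1)%R]muln1 leqnn /= !andbT.
apply/(@freeP _ _ d [tuple (row i P)^t* | i < d]) => c c0 i.
have nth_row (j : 'I_d) : [tuple (row i P)^t* | i < d]`_j = (row j P)^t*.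
  by rewrite -tnth_nth tnth_mktuple.
have := congr1 (fun x => inner x ((row i P)^t*)) c0.
rewrite /inner mulmx0 [RHS]mxE mulmx_sumr summxE (bigD1 i) //= big1 ?addr0 => [|j ji].
  rewrite nth_row -scalemxAr mxE -/(inner _ _).
  by have := on i i; rewrite /inner => ->; rewrite eqxx mulr1.
rewrite nth_row -scalemxAr mxE.
by have := on j i; rewrite /inner => ->; rewrite (negbTE ji) mulr0.
Qed.

(** * Sorted spectra and traces of functions *)

Lemma row_sort (r : rel R) (s : seq R) a :
  transitive r -> antisymmetric r -> total r ->
  (forall i j : 'I_d, (i <= j)%N -> r (a 0 i) (a 0 j)) ->
  perm_eq s [seq a 0 i | i <- enum 'I_d] ->
  \row_i (sort r s)`_i = a.
Proof.
move=> tr asym tot sa sp.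
have -> : sort r s = [seq a 0 i | i <- enum 'I_d].
  apply: (sorted_eq tr asym (sort_sorted tot s)); last by rewrite perm_sort.
  apply: (homo_sorted (e := fun i j : 'I_d => (i <= j)%N)) => [i j|]; first exact: sa.
  by have := iota_sorted 0 d; rewrite -val_enum_ord sorted_map.
by apply/rowP => i; rewrite mxE (nth_map i) ?size_enum_ord // nth_ord_enum.
Qed.

Lemma lambda_downE P a A : diagonalizes P a A ->
  (forall i j : 'I_d, (i <= j)%N -> a 0 j <= a 0 i) -> lambda_down A = a.
Proof.
move=> hA sa; apply: row_sort => //; last exact: Re_eigs_perm hA.
- exact: ge_transitive.
- exact: ge_antisymmetric.
Qed.

Lemma lambda_upE P a A : diagonalizes P a A ->
  (forall i j : 'I_d, (i <= j)%N -> a 0 i <= a 0 j) -> lambda_up A = a.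
Proof.
move=> hA sa; apply: row_sort => //; last exact: Re_eigs_perm hA.
- exact: le_trans.
- exact: le_anti.
Qed.

Lemma lambda_down_rearr P a A : diagonalizes P a A -> lambda_down A = rearr_down a.
Proof.
move=> hA; apply/rowP => i; rewrite !mxE; congr (_ `_ i).
have /perm_sortP := Re_eigs_perm hA; apply.
- exact: ge_total.
- exact: ge_transitive.
- exact: ge_antisymmetric.
Qed.

Lemma PhiE phi P a S G : diagonalizes P a (S + G) ->
  Phi phi S G = \sum_i phi (a 0 i).
Proof.
rewrite /Phi; move: (S + G) => A hA.
pose a' := map_mx (@complex.Re R) (spectral_diag A).
have hA' : diagonalizes (spectralmx A) a' A.
  exact: spectral_diagonalizes (diagonalizes_selfadj hA).
have -> : \tr (fun_calc phi A) = (\sum_i phi (a' 0 i))%:C.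
  rewrite /fun_calc -mulmxA mxtrace_mulC mulmxK ?spectral_unit //.
  rewrite mxtrace_diag rmorph_sum; apply: eq_bigr => i _; by rewrite !mxE.
have sumE (b : 'rV[R]_d) : \sum_i phi (b 0 i) = \sum_(x <- [seq b 0 i | i <- enum 'I_d]) phi x.
  by rewrite big_map big_enum.
rewrite /= !sumE; apply: perm_big.
by apply: perm_trans (Re_eigs_perm hA); rewrite perm_sym (Re_eigs_perm hA').
Qed.

Lemma diagonal_form_sum P a : P^t* *m real_diag a *m P =
  \sum_i (a 0 i)%:C *: ((row i P)^t* *m row i P).
Proof.
apply/matrixP => i j; rewrite mxE summxE; apply: eq_bigr => k _.
rewrite !mxE big_ord1 !mxE mulrA; congr (_ * _).
rewrite (bigD1 k) //= !mxE eqxx mulr1n big1 ?addr0 1?mulrC // => l lk.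
by rewrite !mxE (negbTE lk) mulr0n mulr0.
Qed.

Lemma diagonalizes_perm (s : 'S_d) P a A : diagonalizes P a A ->
  diagonalizes (row_perm s P) (col_perm s a) A.
Proof.
case=> uP ->; split.
  rewrite row_permE; apply: mul_unitarymx uP; apply/unitarymxP.
  by rewrite tr_perm_mx map_perm_mx -perm_mxM mulgV perm_mx1.
rewrite !diagonal_form_sum (reindex_inj (@perm_inj _ s)) /=.
apply: eq_bigr => i _; rewrite mxE; suff -> : row i (row_perm s P) = row (s i) P by [].
by apply/rowP => j; rewrite !mxE.
Qed.

(** Sorting the indices rather than the values lets one permutation act on the
    eigenvectors and on several families of eigenvalues at once. *)
Lemma sorting_perm (r : rel 'I_d) : total r -> transitive r ->
  exists s : 'S_d, forall i j : 'I_d, (i <= j)%N -> r (s i) (s j).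
Proof.
move=> tot tr; have rr : reflexive r by move=> i; have := tot i i; rewrite orbb.
have sz : size (sort r (enum 'I_d)) = d by rewrite size_sort size_enum_ord.
pose f (i : 'I_d) := nth i (sort r (enum 'I_d)) i.
have fE i0 i : f i = nth i0 (sort r (enum 'I_d)) i.
  by apply: set_nth_default; rewrite sz.
have finj : injective f.
  move=> i j; rewrite !(fE i) => /eqP; rewrite nth_uniq ?sz ?sort_uniq ?enum_uniq //.
  by move/eqP/val_inj.
exists (perm finj) => i j ij; rewrite !permE !(fE i).
by apply: (sorted_leq_nth tr rr i (sort_sorted tot (enum 'I_d))); rewrite ?inE ?sz.
Qed.

Lemma selfadj_diag_down A : A^t* = A -> exists P a, diagonalizes P a A /\
  forall i j : 'I_d, (i <= j)%N -> a 0 j <= a 0 i.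
Proof.
move=> /selfadj_diag[P [a hA]].
have [|x y z /=|s hs] := sorting_perm (r := fun i j => a 0 j <= a 0 i).
- by move=> i j; apply: le_total.
- by move=> h1 h2; apply: le_trans h2 h1.
exists (row_perm s P), (col_perm s a); split; first exact: diagonalizes_perm.
by move=> i j ij; rewrite !mxE hs.
Qed.

(** * Quadratic forms and positivity *)

Definition normsq (z : R[i]) : R := complex.Re z ^+ 2 + complex.Im z ^+ 2.

Lemma normsqE (z : R[i]) : z * z^* = (normsq z)%:C.
Proof.
case: z => x y; apply/eqP; rewrite eq_complex /normsq /=; apply/andP; split; apply/eqP; ring.
Qed.

Lemma normsq_ge0 z : 0 <= normsq z.
Proof. by rewrite addr_ge0 ?sqr_ge0. Qed.

Lemma normsq_eq0 z : (normsq z == 0) = (z == 0).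
Proof. by case: z => x y; rewrite /normsq paddr_eq0 ?sqr_ge0 // !sqrf_eq0 eq_complex. Qed.

Lemma mul_trmxC_normsq m (x : 'rV[R[i]]_m) :
  (x *m x^t*) 0 0 = (\sum_k normsq (x 0 k))%:C.
Proof.
rewrite mxE rmorph_sum; by apply: eq_bigr => k _; rewrite /= -normsqE !mxE.
Qed.

Lemma quad_real_diag (x : 'rV[R[i]]_d) a :
  (x *m real_diag a *m x^t*) 0 0 = (\sum_k a 0 k * normsq (x 0 k))%:C.
Proof.
rewrite mxE rmorph_sum; apply: eq_bigr => k _.
rewrite mul_mx_diag !mxE mulrAC normsqE mulrC.
by rewrite -rmorphM.
Qed.

Lemma quad_diagonalizes P a A (x : 'rV[R[i]]_d) : diagonalizes P a A ->
  (x *m A *m x^t*) 0 0 = (\sum_k a 0 k * normsq ((x *m P^t*) 0 k))%:C.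
Proof.
by case=> uP ->; rewrite -quad_real_diag trmxCM trmxCK !mulmxA.
Qed.

Lemma quad_ge0 P a A (x : 'rV[R[i]]_d) : diagonalizes P a A ->
  (forall i, 0 <= a 0 i) -> 0 <= (x *m A *m x^t*) 0 0.
Proof.
move=> hA a0; rewrite (quad_diagonalizes _ hA) ler0c sumr_ge0 // => k _.
by rewrite mulr_ge0 ?normsq_ge0.
Qed.

Lemma quad_eigenvector P a A i : diagonalizes P a A ->
  (row i P *m A *m (row i P)^t*) 0 0 = (a 0 i)%:C.
Proof.
move=> hA; rewrite (quad_diagonalizes _ hA) -row_mul (unitarymxP hA.1).
congr (_%:C); rewrite (bigD1 i) //= !mxE eqxx /normsq /= big1 => [|k ki].
  by rewrite expr1n expr0n /= !addr0 mulr1.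
by rewrite !mxE eq_sym (negbTE ki) /= expr0n /= addr0 mulr0.
Qed.

Lemma psdmx_diagonalizes P a A : diagonalizes P a A ->
  psdmx A <-> forall i, 0 <= a 0 i.
Proof.
move=> hA; split=> [[_ psd] i|a0].
  have := psd ((row i P)^t*); rewrite /inner mulmxA trmxCK.
  by rewrite (quad_eigenvector _ hA) ler0c.
split; first by apply/selfadjP; apply: diagonalizes_selfadj hA.
by move=> x; rewrite /inner mulmxA -{2}[x]trmxCK (quad_ge0 _ hA).
Qed.

Lemma psdmxD A B : psdmx A -> psdmx B -> psdmx (A + B).
Proof.
move=> [/selfadjP sA A0] [/selfadjP sB B0].
split; first by apply/selfadjP; rewrite trmxCD sA sB.
by move=> x; rewrite /inner mulmxDl mulmxDr mxE addr_ge0 ?A0 ?B0.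
Qed.

(** The orbit is [{P^* D_mu P : P unitary}]; in this form its stability under
    unitary conjugation is evident. *)
Lemma orbit_muP (mu : 'rV[R]_d) G :
  (forall i j : 'I_d, (i <= j)%N -> mu 0 j <= mu 0 i) ->
  (forall i : 'I_d, 0 <= mu 0 i) ->
  orbit_mu mu G <-> exists P, diagonalizes P mu G.
Proof.
move=> mud mu0; split=> [[[/selfadjP hG _] lG]|[P hG]].
  have [P [a [hP ad]]] := selfadj_diag_down hG.
  by exists P; rewrite -lG (lambda_downE hP).
by split; [apply/(psdmx_diagonalizes hG) | apply: lambda_downE hG _].
Qed.

(** * Strict convexity of the trace *)

Lemma unitary_row_normsq W i : W \is unitarymx -> \sum_j normsq (W i j) = 1.
Proof.
move=> uW; apply: complexI; rewrite rmorph1.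
have /matrixP /(_ i i) := unitarymxP uW; rewrite [RHS]mxE eqxx mxE => /= e1.
by rewrite -[RHS]/(true%:R) -e1 rmorph_sum; apply: eq_bigr => k _; rewrite /= -normsqE !mxE.
Qed.

Lemma unitary_col_normsq W j : W \is unitarymx -> \sum_i normsq (W i j) = 1.
Proof.
rewrite -trmx_unitary => /(unitary_row_normsq j) <-.
by apply: eq_bigr => i _; rewrite mxE.
Qed.

(** [U P^*] is the change of basis between the two eigenbases. The hypothesis says
    that only eigenvectors with equal eigenvalues overlap, that is, [U P^*]
    intertwines the two diagonal matrices. *)
Lemma eq_of_spectral_overlap P a A U b B : diagonalizes P a A -> diagonalizes U b B ->
  (forall i j, (U *m P^t*) i j != 0 -> a 0 j = b 0 i) -> A = B.
Proof.
move=> hA hB ov; have [uP eA] := hA; have [uU eB] := hB.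
have comm : U *m P^t* *m real_diag a = real_diag b *m (U *m P^t*).
  move: (U *m P^t*) ov => V ov; apply/matrixP => i j.
  rewrite mul_mx_diag mul_diag_mx !mxE mulrC.
  by have [->|/ov ->//] := eqVneq (V i j) 0; rewrite !mulr0.
have UA : U *m A = U *m B.
  rewrite [RHS](diagonalizes_conj hB) eA !mulmxA comm -!mulmxA.
  by rewrite (unitarymx_trmxCl uP) mulmx1.
by rewrite -[A]mul1mx -[B]mul1mx -(unitarymx_trmxCl uU) -!mulmxA UA.
Qed.

(** In an eigenbasis of the convex combination, its eigenvalues are the image of
    the common spectrum [a] under a doubly stochastic matrix built from the
    squared moduli of the two changes of basis. Equality in Jensen then shows
    that both matrices coincide with the combination. *)
Lemma strict_trace_convexity phi (k : R) A B P Q U a b :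
  strictly_convex_nneg phi -> 0 < k -> k < 1 ->
  diagonalizes P a A -> diagonalizes Q a B ->
  diagonalizes U b (k%:C *: A + (1 - k)%:C *: B) ->
  (forall i, 0 <= a 0 i) ->
  \sum_i phi (a 0 i) <= \sum_i phi (b 0 i) -> A = B.
Proof.
move=> cvx k0 k1 hA hB hK a0 le.
have uV := mul_unitarymx hK.1 (trmxC_unitarymx hA.1).
have uV' := mul_unitarymx hK.1 (trmxC_unitarymx hB.1).
pose T i j := k * normsq ((U *m P^t*) i j) + (1 - k) * normsq ((U *m Q^t*) i j).
have T0 i j : 0 <= T i j by rewrite addr_ge0 ?mulr_ge0 ?normsq_ge0 //; lra.
have row1 i : \sum_j T i j = 1.
  rewrite big_split -!mulr_sumr (unitary_row_normsq i uV) (unitary_row_normsq i uV') /=; lra.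
have col1 j : \sum_i T i j = 1.
  rewrite big_split -!mulr_sumr (unitary_col_normsq j uV) (unitary_col_normsq j uV') /=; lra.
have bT i : b 0 i = \sum_j T i j * a 0 j.
  apply: complexI; rewrite -(quad_eigenvector i hK) mulmxDr mulmxDl.
  rewrite -!scalemxAr -!scalemxAl [LHS]mxE [X in X + _]mxE [X in _ + X]mxE.
  rewrite (quad_diagonalizes _ hA) (quad_diagonalizes _ hB) -!rmorphM -rmorphD.
  congr (_%:C); rewrite !mulr_sumr -big_split; apply: eq_bigr => j _ /=.
  rewrite -!row_mul ![row _ _ _ _]mxE /T; ring.
have eqv := doubly_stochastic_eq cvx T0 row1 col1 a0 bT le.
transitivity (k%:C *: A + (1 - k)%:C *: B).
  apply: (eq_of_spectral_overlap hA hK) => i j nz; apply: eqv.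
  rewrite gt_eqF // ltr_pwDl ?mulr_ge0 ?normsq_ge0 //; last by lra.
  by rewrite mulr_gt0 // lt_def normsq_eq0 nz normsq_ge0.
apply/esym/(eq_of_spectral_overlap hB hK) => i j nz; apply: eqv.
rewrite gt_eqF // ltr_wpDl ?mulr_ge0 ?normsq_ge0 //; first by lra.
by rewrite mulr_gt0 ?subr_gt0 // lt_def normsq_eq0 nz normsq_ge0.
Qed.

(** * Cayley transforms near the identity *)

(** If [v = v X] with [X] skew-adjoint, then [v v^*] equals its own opposite. *)
Lemma unit_one_sub_skew X : X^t* = - X -> 1%:M - X \in unitmx.
Proof.
move=> sX; rewrite -row_free_unit; apply: inj_row_free => v.
rewrite mulmxBr mulmx1 => /eqP; rewrite subr_eq0 => /eqP evX.
have vv : v *m v^t* = - (v *m v^t*).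
  by rewrite {2}evX trmxCM sX mulNmx mulmxN mulmxA -evX.
have /eqP : \sum_k normsq (v 0 k) = 0.
  apply: complexI; rewrite -mul_trmxC_normsq rmorph0.
  move/matrixP/(_ 0 0): vv; rewrite [RHS]mxE => /eqP.
  by rewrite -addr_eq0 -mulr2n mulrn_eq0 => /eqP.
rewrite psumr_eq0 => [/allP v0|k _]; last exact: normsq_ge0.
apply/rowP => k; rewrite mxE; apply/eqP; rewrite -normsq_eq0.
exact: (implyP (v0 k (mem_index_enum k))).
Qed.

Definition cayley X : 'M[R[i]]_d := invmx (1%:M - X) *m (1%:M + X).

Lemma cayleyE X : X^t* = - X -> (1%:M - X) *m cayley X = 1%:M + X.
Proof. by move=> sX; rewrite /cayley mulKVmx // unit_one_sub_skew. Qed.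

Lemma cayley_unitary X : X^t* = - X -> cayley X \is unitarymx.
Proof.
move=> sX; have uX := unit_one_sub_skew sX.
have comm : (1%:M + X) *m (1%:M - X) = (1%:M - X) *m (1%:M + X).
  by rewrite mulmxBr mulmxBl !mulmx1 !mul1mx mulmxDl mulmxDr mul1mx mulmx1.
have adj : (1%:M + X) *m (invmx (1%:M - X))^t* = 1%:M.
  have -> : 1%:M + X = (1%:M - X)^t* by rewrite trmxCD trmxCN trmxC1 sX opprK.
  by rewrite -trmxCM mulVmx // trmxC1.
apply/unitarymxP; rewrite /cayley trmxCM trmxCD trmxC1 sX.
by rewrite mulmxA -[_ *m _ *m (1%:M - X)]mulmxA comm mulKmx // adj.
Qed.

Lemma cayley_sub1 X : X^t* = - X -> cayley X - 1%:M = X *m (1%:M + cayley X).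
Proof.
move=> /cayleyE; rewrite mulmxBl mul1mx => /eqP; rewrite subr_eq => /eqP e.
by rewrite mulmxDr mulmx1 {1}e addrC !addrA addNr add0r.
Qed.

(** [X] and its Cayley transform are rational functions of each other: the key to
    the converse is that [1 + cayley X] is invertible, with inverse
    [(1 - X) / 2]. *)
Lemma cayley_comm X B : X^t* = - X ->
  B *m X = X *m B <-> B *m cayley X = cayley X *m B.
Proof.
move=> sX; have uX := unit_one_sub_skew sX; split=> [cBX|cBW].
  apply: (can_inj (mulKmx uX)); rewrite [LHS]mulmxA [RHS]mulmxA cayleyE //.
  have -> : (1%:M - X) *m B = B *m (1%:M - X).
    by rewrite mulmxBl mulmxBr mul1mx mulmx1 cBX.
  by rewrite -mulmxA cayleyE // mulmxDr mulmxDl mul1mx mulmx1 cBX.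
have inv2 : (1%:M + cayley X) *m (1%:M - X) = 2%:R%:M.
  apply: (can_inj (mulKmx uX)); rewrite mulmxA.
  have -> : (1%:M - X) *m (1%:M + cayley X) = 2%:R%:M.
    by rewrite mulmxDr mulmx1 cayleyE // addrACA addNr addr0 -raddfD.
  by rewrite mul_scalar_mx mul_mx_scalar.
have H : B *m X *m (1%:M + cayley X) = X *m B *m (1%:M + cayley X).
  have e : B *m (1%:M + cayley X) = (1%:M + cayley X) *m B.
    by rewrite mulmxDr mulmxDl mulmx1 mul1mx cBW.
  rewrite -[LHS]mulmxA -[RHS]mulmxA e -cayley_sub1 // [RHS]mulmxA -cayley_sub1 //.
  by rewrite mulmxBr mulmxBl mulmx1 mul1mx cBW.
move/(congr1 (mulmx^~ (1%:M - X))): H; rewrite -!(mulmxA _ (1%:M + _)) inv2 !mul_mx_scalar.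
by apply: scalerI; rewrite pnatr_eq0.
Qed.

(** A submultiplicative norm that dominates the operator norm, chosen because it is
    computed entrywise. *)
Definition entry_sum A : R[i] := \sum_i \sum_j `|A i j|.

Lemma entry_sum_ge0 A : 0 <= entry_sum A.
Proof. by rewrite sumr_ge0 // => i _; rewrite sumr_ge0. Qed.

Lemma entry_sumD A B : entry_sum (A + B) <= entry_sum A + entry_sum B.
Proof.
rewrite /entry_sum -big_split ler_sum // => i _; rewrite -big_split ler_sum // => j _.
by rewrite mxE ler_normD.
Qed.

Lemma entry_sumN A : entry_sum (- A) = entry_sum A.
Proof. by apply: eq_bigr => i _; apply: eq_bigr => j _; rewrite mxE normrN. Qed.

Lemma entry_sumZ c A : entry_sum (c *: A) = `|c| * entry_sum A.
Proof.
rewrite /entry_sum mulr_sumr; apply: eq_bigr => i _.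
by rewrite mulr_sumr; apply: eq_bigr => j _; rewrite mxE normrM.
Qed.

Lemma entry_sumM A B : entry_sum (A *m B) <= entry_sum A * entry_sum B.
Proof.
rewrite /entry_sum mulr_suml ler_sum // => i _.
apply: (@le_trans _ _ (\sum_j \sum_k `|A i k| * `|B k j|)).
  apply: ler_sum => j _; rewrite mxE; apply: le_trans (ler_norm_sum _ _ _) _.
  by apply: ler_sum => k _; rewrite normrM.
rewrite exchange_big mulr_suml ler_sum //= => k _.
rewrite -mulr_sumr ler_wpM2l // [leRHS](bigD1 k) //= lerDl.
by rewrite sumr_ge0 // => l _; rewrite sumr_ge0.
Qed.

Lemma normsq_norm (z : R[i]) : (normsq z)%:C = `|z| ^+ 2.
Proof. by rewrite -add_Re2_Im2. Qed.

Lemma entry_sum_unitary W : W \is unitarymx -> entry_sum W <= (d * d)%:R.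
Proof.
move=> uW; apply: (@le_trans _ _ (\sum_(i < d) \sum_(j < d) 1)).
  apply: ler_sum => i _; apply: ler_sum => j _.
  rewrite -(@expr_le1 _ 2) // -normsq_norm -(rmorph1 (real_complex R)) lecR.
  rewrite -(unitary_row_normsq i uW) (bigD1 j) //= lerDl sumr_ge0 // => k _.
  exact: normsq_ge0.
by rewrite !sumr_const card_ord natrM mulr_natr.
Qed.

Lemma l2normE (x : 'cV[R[i]]_d) : l2norm x = Num.sqrt (\sum_k normsq (x k 0)).
Proof.
rewrite /l2norm; congr Num.sqrt; apply: complexI.
have -> : inner x x = (\sum_k normsq (x k 0))%:C; last by [].
rewrite /inner mxE rmorph_sum; apply: eq_bigr => k _.
by rewrite /= -normsqE !mxE mulrC.
Qed.

Lemma opnorm_le_entry_sum A : opnorm A <= complex.Re (entry_sum A).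
Proof.
have eA : (complex.Re (entry_sum A))%:C = entry_sum A.
  by apply: RRe_real; apply: ger0_real; apply: entry_sum_ge0.
rewrite /opnorm; apply: ge_sup.
  exists (l2norm (A *m 0)); exists 0 => //=.
  rewrite l2normE big1 ?sqrtr0 // => k _.
  by rewrite mxE /normsq /= expr0n addr0.
move=> _ [x /= x1 <-].
have xk k : `|x k 0| <= 1.
  rewrite -(@expr_le1 _ 2) // -normsq_norm -(rmorph1 (real_complex R)) lecR.
  move: x1; rewrite l2normE => x1.
  have : \sum_k normsq (x k 0) <= 1.
    rewrite -(sqr_sqrtr (_ : 0 <= \sum_k normsq (x k 0))); last first.
      by apply: sumr_ge0 => *; apply: normsq_ge0.
    by rewrite expr_le1 // sqrtr_ge0.
  apply: le_trans; rewrite (bigD1 k) //= lerDl sumr_ge0 // => l _.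
  exact: normsq_ge0.
have A0 : 0 <= complex.Re (entry_sum A) by rewrite -ler0c eA entry_sum_ge0.
rewrite l2normE -[leRHS](ger0_norm A0) -sqrtr_sqr ler_wsqrtr //.
rewrite -lecR rmorphXn /= eA rmorph_sum /= expr2 {1}/entry_sum mulr_suml.
apply: ler_sum => i _; rewrite normsq_norm expr2.
have r0 : 0 <= \sum_j `|A i j| by apply: sumr_ge0.
have le1 : `|(A *m x) i 0| <= \sum_j `|A i j|.
  rewrite mxE; apply: le_trans (ler_norm_sum _ _ _) _; apply: ler_sum => j _.
  by rewrite normrM ler_piMr.
apply: ler_pM => //; apply: le_trans le1 _.
by rewrite /entry_sum [leRHS](bigD1 i) //= lerDl sumr_ge0 // => l _; rewrite sumr_ge0.
Qed.

Lemma trmxC_imagZ (t : R) H : H^t* = H ->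
  ((Complex 0 t) *: H)^t* = - ((Complex 0 t) *: H).
Proof.
move=> sH; rewrite trmxCZ sH -scaleNr; congr (_ *: _).
by apply/eqP; rewrite eq_complex /= oppr0 !eqxx.
Qed.

(** The Cayley transform [W] of [X = i t H] satisfies [W - 1 = X (1 + W)], and the
    entries of [W] are bounded independently of [t], so [W G W^* - G] is of order
    [t]. *)
Lemma cayley_near H G (e : R) : H^t* = H -> 0 < e ->
  exists2 t : R, 0 < t & let W := cayley (Complex 0 t *: H) in
    opnorm (W *m G *m W^t* - G) < e.
Proof.
move=> sH e0; pose c : R[i] := (d * d)%:R.
(* the derived bound on [W G W^* - G] is [t K]; [c] bounds the norm of a unitary *)
pose K := 2 * entry_sum H * (c + c) * entry_sum G * c.
have c0 : 0 <= c by rewrite ler0n.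
have K0 : 0 <= K by rewrite !mulr_ge0 ?addr_ge0 ?entry_sum_ge0.
have eK : (complex.Re K)%:C = K by apply: RRe_real; apply: ger0_real.
have K0' : 0 <= complex.Re K by rewrite -ler0c eK.
have K1 : 0 < complex.Re K + 1 by lra.
exists (e / (complex.Re K + 1)); first by rewrite divr_gt0.
set t := e / _; have t0 : 0 < t by rewrite divr_gt0.
set X := _ *: H => W.
have sX : X^t* = - X by apply: trmxC_imagZ.
have uW : W \is unitarymx by apply: cayley_unitary.
apply: le_lt_trans (opnorm_le_entry_sum _) _.
suff le : entry_sum (W *m G *m W^t* - G) <= (t * complex.Re K)%:C.
  have : complex.Re (entry_sum (W *m G *m W^t* - G)) <= t * complex.Re K.
    by move: le; rewrite lecE => /andP[].
  move=> /le_lt_trans; apply; rewrite /t mulrAC ltr_pdivrMr //; lra.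
have -> : W *m G *m W^t* - G =
    (X *m (1%:M + W) *m G - G *m (X *m (1%:M + W))) *m W^t*.
  rewrite -cayley_sub1 // !(mulmxBl, mulmxBr) mul1mx mulmx1 -/W.
  rewrite -[G *m W *m W^t*]mulmxA (unitarymxP uW) mulmx1.
  by rewrite opprB addrA subrK.
have N1W : entry_sum (1%:M + W) <= c + c.
  apply: le_trans (entry_sumD _ _) _; apply: lerD; last exact: entry_sum_unitary.
  by apply: entry_sum_unitary; apply/unitarymxP; rewrite trmxC1 mulmx1.
have NX : entry_sum X = t%:C * entry_sum H.
  rewrite entry_sumZ; congr (_ * _).
  by rewrite normc_def /= expr0n add0r sqrtr_sqr gtr0_norm.
have NXW : entry_sum (X *m (1%:M + W)) <= t%:C * entry_sum H * (c + c).
  apply: le_trans (entry_sumM _ _) _; rewrite NX.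
  by apply: ler_wpM2l => //; rewrite mulr_ge0 ?entry_sum_ge0 // ler0c ltW.
apply: le_trans (entry_sumM _ _) _.
have -> : (t * complex.Re K)%:C =
  (t%:C * entry_sum H * (c + c) * entry_sum G + entry_sum G * (t%:C * entry_sum H * (c + c))) * c.
  rewrite rmorphM /= eK /K; ring.
apply: ler_pM; rewrite ?entry_sum_ge0 //; last first.
  exact: entry_sum_unitary (trmxC_unitarymx uW).
apply: le_trans (entry_sumD _ _) _; rewrite entry_sumN.
apply: lerD; apply: le_trans (entry_sumM _ _) _.
  by apply: ler_wpM2r; rewrite ?entry_sum_ge0.
by apply: ler_wpM2l; rewrite ?entry_sum_ge0.
Qed.

(** * Local minimizers *)

(** The operator exchanging the [i]-th and [j]-th eigenvectors and annihilating
    the others. *)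
Definition swap_op P (i j : 'I_d) : 'M[R[i]]_d :=
  P^t* *m (delta_mx i j + delta_mx j i) *m P.

Lemma swap_op_selfadj P i j : (swap_op P i j)^t* = swap_op P i j.
Proof.
rewrite /swap_op !trmxCM trmxCK mulmxA trmxCD !trmx_delta !map_delta_mx.
by rewrite [X in _ *m X *m _]addrC.
Qed.

Lemma swap_op_comm P a A i j : i != j -> diagonalizes P a A ->
  swap_op P i j *m A = A *m swap_op P i j <-> a 0 i = a 0 j.
Proof.
move=> ij [uP ->]; rewrite /swap_op.
set E := _ + _; set D := real_diag a.
have -> : P^t* *m E *m P *m (P^t* *m D *m P) = P^t* *m (E *m D) *m P.
  by rewrite !mulmxA (mulmxtVK _ uP).
have -> : P^t* *m D *m P *m (P^t* *m E *m P) = P^t* *m (D *m E) *m P.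
  by rewrite !mulmxA (mulmxtVK _ uP).
split=> [|aij].
  move=> /(congr1 (fun M => P *m M *m P^t*)).
  rewrite !mulmxA (unitarymxP uP) !mul1mx -!mulmxA (unitarymxP uP) !mulmx1.
  move/matrixP/(_ i j); rewrite mul_mx_diag mul_diag_mx !mxE !eqxx (negbTE ij) /=.
  by rewrite addr0 mul1r mulr1 => /complexI.
suff -> : E *m D = D *m E by []; apply/matrixP => p q.
rewrite mul_mx_diag mul_diag_mx !mxE.
have [/andP[/eqP-> /eqP->]|_] := boolP ((p == i) && (q == j)); first by rewrite aij mulrC.
have [/andP[/eqP-> /eqP->]|_] := boolP ((p == j) && (q == i)); first by rewrite aij mulrC.
by rewrite addr0 mul0r mulr0.
Qed.

(** The convex-combination identity at work: conjugating [G0] by a unitary close to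
    [1] that commutes with [(1 - k) S - k G0] would strictly decrease [Phi] unless
    that unitary commutes with [S + G0]. *)
Lemma local_min_comm phi S G0 (mu : 'rV[R]_d) (k : R) H :
  psdmx S ->
  (forall i j : 'I_d, (i <= j)%N -> mu 0 j <= mu 0 i) ->
  (forall i : 'I_d, 0 <= mu 0 i) ->
  strictly_convex_nneg phi -> local_minimizer_on (orbit_mu mu) (Phi phi S) G0 ->
  0 < k -> k < 1 -> H^t* = H ->
  H *m ((1 - k)%:C *: S - k%:C *: G0) = ((1 - k)%:C *: S - k%:C *: G0) *m H ->
  H *m (S + G0) = (S + G0) *m H.
Proof.
move=> Spsd mud mu0 cvx [OG0 [e e0 Gmin]] k0 k1 sH cHM.
set M := _ - _ in cHM.
have [Q hG] := (orbit_muP _ mud mu0).1 OG0.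
have /selfadjP sS := Spsd.1.
have sA : (S + G0)^t* = S + G0 by rewrite trmxCD sS (diagonalizes_selfadj hG).
have [P [a hA]] := selfadj_diag sA.
have a0 : forall i, 0 <= a 0 i.
  by apply/(psdmx_diagonalizes hA)/psdmxD; [exact: Spsd | exact: OG0.1].
have [t t0 near] := cayley_near G0 sH e0.
set X := Complex 0 t *: H in near; pose W := cayley X; rewrite -/W in near.
have sX : X^t* = - X by apply: trmxC_imagZ.
have uW : W \is unitarymx by apply: cayley_unitary.
have XB B : B *m X = X *m B <-> B *m H = H *m B.
  rewrite -scalemxAl -scalemxAr; split=> [|->//].
  by apply: scalerI; rewrite eq_complex /= negb_and (gt_eqF t0) orbT.
have WM : M *m W = W *m M by apply/(cayley_comm _ sX)/XB/esym.
have hG' := diagonalizes_unitary_conj uW hG.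
have hA' := diagonalizes_unitary_conj uW hA.
have OG : orbit_mu mu (W *m G0 *m W^t*) by apply/(orbit_muP _ mud mu0); eexists; exact: hG'.
(* [S = k A + M], while [W M W^* = M] turns [W ((1 - k) A) W^*] into
   [M + W G0 W^*], where [A = S + G0] *)
have eB : S + W *m G0 *m W^t* =
    k%:C *: (S + G0) + (1 - k)%:C *: (W *m (S + G0) *m W^t*).
  have eS : k%:C *: (S + G0) + M = S.
    rewrite /M scalerDr rmorphB rmorph1 scalerBl scale1r.
    by rewrite addrACA [X in _ + X]addrN addr0 addrC subrK.
  have eA : (1 - k)%:C *: (S + G0) = M + G0.
    rewrite /M scalerDr -addrA; congr (_ + _).
    by rewrite rmorphB rmorph1 scalerBl scale1r addrC.
  rewrite -{1}eS -addrA; congr (_ + _).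
  rewrite scalemxAl scalemxAr eA mulmxDr mulmxDl; congr (_ + _).
  by rewrite -WM (mulmxtVK _ uW).
have sB : (S + W *m G0 *m W^t*)^t* = S + W *m G0 *m W^t*.
  by rewrite trmxCD sS (diagonalizes_selfadj hG').
have [U [b hB]] := selfadj_diag sB.
have le := Gmin _ OG near.
rewrite (PhiE phi hA) (PhiE phi hB) in le.
rewrite eB in hB.
have eqA := strict_trace_convexity cvx k0 k1 hA hA' hB a0 le.
apply/esym/XB/(cayley_comm _ sX); rewrite -/W {1}eqA.
by rewrite -mulmxA (unitarymx_trmxCl uW) mulmx1.
Qed.

(** Ties in [a] are broken by [b]. *)
Lemma opposite_sorting_perm a b :
  (forall i j, a 0 i < a 0 j -> b 0 j <= b 0 i) ->
  exists s : 'S_d, forall i j : 'I_d, (i <= j)%N ->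
    a 0 (s i) <= a 0 (s j) /\ b 0 (s j) <= b 0 (s i).
Proof.
move=> opp.
pose r i j := (a 0 i < a 0 j) || (a 0 i == a 0 j) && (b 0 j <= b 0 i).
have [i j|j i k|s hs] := sorting_perm (r := r).
- by rewrite /r; case: (ltgtP (a 0 i) (a 0 j)) => //= _; apply: le_total.
- rewrite /r => /orP[ij|/andP[/eqP-> bij]] /orP[jk|/andP[/eqP <- bjk]].
  + by rewrite (lt_trans ij jk).
  + by rewrite ij.
  + by rewrite jk.
  + by rewrite eqxx (le_trans bjk bij) orbT.
exists s => i j /hs /orP[lt|/andP[/eqP-> ->]]; last by rewrite lexx.
by rewrite (ltW lt) opp.
Qed.

Lemma local_min_codiagonal phi S G0 (mu : 'rV[R]_d) :
  psdmx S ->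
  (forall i j : 'I_d, (i <= j)%N -> mu 0 j <= mu 0 i) ->
  (forall i : 'I_d, 0 <= mu 0 i) ->
  strictly_convex_nneg phi -> local_minimizer_on (orbit_mu mu) (Phi phi S) G0 ->
  exists P, [/\ diagonalizes P (lambda_up S) S, diagonalizes P mu G0 &
    forall i j : 'I_d, (i <= j)%N -> lambda_up S 0 i <= lambda_up S 0 j].
Proof.
move=> Spsd mud mu0 cvx Gmin.
have comm := local_min_comm Spsd mud mu0 cvx Gmin.
have /selfadjP sS := Spsd.1.
have [[/selfadjP sG _] lG] := Gmin.1.
(* [k = 1/2] and [H = S - G0]: the commutator of [S - G0] and [S + G0] is twice
   that of [S] and [G0] *)
have cSG : S *m G0 = G0 *m S.
  have H : (S - G0) *m (S + G0) = (S + G0) *m (S - G0).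
    apply: (comm 2^-1); rewrite ?invr_gt0 ?invf_lt1 ?ltr1n ?ltr0n //.
      by rewrite trmxCD trmxCN sS sG.
    have -> : 1 - 2^-1 = 2^-1 :> R by lra.
    by rewrite -scalerBr -scalemxAl -scalemxAr.
  move: H; rewrite mulmxBl mulmxBr !mulmxDl !mulmxDr => H.
  move: (S *m S) (S *m G0) (G0 *m S) (G0 *m G0) H => x y z w /matrixP H.
  apply/matrixP => i j; have := H i j; rewrite !mxE => Hij.
  have /eqP : 2%:R * (y i j - z i j) = 0.
    by rewrite -[RHS](subrr (x i j + y i j - (z i j + w i j))) {2}Hij; ring.
  by rewrite mulf_eq0 pnatr_eq0 /= subr_eq0 => /eqP.
have [P [s [g [hS hG]]]] := codiagonalization sS sG cSG.
have opp i j : s 0 i < s 0 j -> g 0 j <= g 0 i.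
  move=> sij; rewrite leNgt; apply/negP => gij.
  have ij : i != j by apply: contraTneq sij => ->; rewrite ltxx.
  (* this [k] solves [(1 - k) s_i - k g_i = (1 - k) s_j - k g_j] *)
  pose k := (s 0 j - s 0 i) / ((s 0 j - s 0 i) + (g 0 j - g 0 i)).
  have den : 0 < (s 0 j - s 0 i) + (g 0 j - g 0 i) by lra.
  have k0 : 0 < k by rewrite divr_gt0 // subr_gt0.
  have k1 : k < 1 by rewrite ltr_pdivrMr // mul1r; lra.
  have hA := diagonalizesD hS hG.
  have hM := diagonalizesD (diagonalizesZ (1 - k) hS) (diagonalizesN (diagonalizesZ k hG)).
  have := comm k _ k0 k1 (swap_op_selfadj P i j).
  rewrite (swap_op_comm ij hM) (swap_op_comm ij hA) !mxE => H.
  have : s 0 i + g 0 i = s 0 j + g 0 j by apply: H; rewrite /k; field; rewrite gt_eqF.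
  by lra.
have [p hp] := opposite_sorting_perm opp.
have hS' := diagonalizes_perm p hS; have hG' := diagonalizes_perm p hG.
have su (i j : 'I_d) : (i <= j)%N -> col_perm p s 0 i <= col_perm p s 0 j.
  by move=> ij; rewrite !mxE; case: (hp i j ij).
exists (row_perm p P); rewrite (lambda_upE hS' su); split; [exact: hS' | | exact: su].
rewrite -lG (lambda_downE hG') => [|i j ij]; first exact: hG'.
by rewrite !mxE; case: (hp i j ij).
Qed.

(** * Majorization of the spectrum of a sum *)

(** The span of the first [j + 1] eigenvectors of [A] meets the span of the
    eigenvectors of [B] of index at least [j], for dimension reasons; compare the
    two quadratic forms on a common nonzero vector. *)
Lemma weyl_monotonicity P a A Q b B : diagonalizes P a A -> diagonalizes Q b B ->
  (forall i j : 'I_d, (i <= j)%N -> a 0 j <= a 0 i) ->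
  (forall i j : 'I_d, (i <= j)%N -> b 0 j <= b 0 i) ->
  (forall x : 'rV[R[i]]_d, 0 <= (x *m (B - A) *m x^t*) 0 0) ->
  forall j, a 0 j <= b 0 j.
Proof.
move=> hA hB ad bd le j.
pose M := \matrix_(i < j.+1, k < j)
  (P *m Q^t*) (widen_ord (ltn_ord j) i) (widen_ord (ltnW (ltn_ord j)) k).
(* [j] linear conditions on [j + 1] coefficients: orthogonality to the first [j]
   eigenvectors of [B] *)
have [u u0 uM] : exists2 u : 'rV_j.+1, u != 0 & u *m M = 0.
  have : ~~ row_free M.
    by apply/negP => /eqP rM; have := rank_leq_col M; rewrite rM ltnn.
  apply: contraNP => H; apply: inj_row_free => v vM.
  by apply/eqP; apply: contra_notT H => v0; exists v.
pose y : 'rV[R[i]]_d := \row_k (if (k <= j)%N then u 0 (inord k) else 0).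
pose w := y *m P *m Q^t*.
have wz (k : 'I_d) : (k < j)%N -> w 0 k = 0.
  move=> kj; have /rowP /(_ (Ordinal kj)) uMk := uM; rewrite !mxE in uMk.
  rewrite -[RHS]uMk {uMk} /w -mulmxA mxE (bigID (fun i : 'I_d => (i <= j)%N)) /=.
  rewrite [X in _ + X]big1 ?addr0; last by move=> i /negbTE ij; rewrite mxE ij mul0r.
  rewrite (reindex_onto (widen_ord (ltn_ord j)) (fun i => inord i)) /=; last first.
    by move=> i ij; apply/val_inj; rewrite /= inordK.
  apply: eq_big => i /=; first by rewrite -ltnS ltn_ord inord_val eqxx.
  move=> _; rewrite [y _ _]mxE /= -ltnS ltn_ord inord_val; congr (_ * _).
  rewrite [M _ _]mxE; congr ((_ *m _) _ _); exact/val_inj.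
have yz (k : 'I_d) : (j < k)%N -> y 0 k = 0 by rewrite ltnNge mxE => /negbTE ->.
have uP := hA.1; have uQ := hB.1.
have e1 := quad_diagonalizes (y *m P) hA.
rewrite (mulmxtVK _ uP) in e1.
have e2 := quad_diagonalizes (y *m P) hB.
rewrite -/w in e2.
have nyw : \sum_k normsq (y 0 k) = \sum_k normsq (w 0 k).
  apply: complexI; rewrite -!mul_trmxC_normsq /w !trmxCM !trmxCK !mulmxA.
  by rewrite (mulmxKtV _ uQ erefl) (mulmxtVK _ uP).
have ny0 : 0 < \sum_k normsq (y 0 k).
  rewrite lt_def sumr_ge0 ?andbT; last by move=> *; apply: normsq_ge0.
  rewrite psumr_eq0; last by move=> *; apply: normsq_ge0.
  apply: contra u0 => /allP y0; apply/eqP/rowP => i; rewrite mxE.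
  have := y0 (widen_ord (ltn_ord j) i); rewrite mem_index_enum normsq_eq0 => /(_ isT) /eqP.
  by rewrite mxE /= -ltnS ltn_ord inord_val.
have := le (y *m P); rewrite mulmxBr mulmxBl mxE [X in _ + X]mxE e1 e2.
rewrite -rmorphB ler0c subr_ge0 => ineq.
rewrite -(ler_pM2r ny0) {2}nyw !mulr_sumr.
apply: le_trans (le_trans ineq _).
- apply: ler_sum => k _; have [kj|jk] := leqP k j.
    by rewrite ler_wpM2r ?normsq_ge0 ?ad.
  by rewrite yz // /normsq /= expr0n /= addr0 !mulr0.
- apply: ler_sum => k _; have [kj|jk] := ltnP k j.
    by rewrite wz // /normsq /= expr0n /= addr0 !mulr0.
  by rewrite ler_wpM2r ?normsq_ge0 ?bd.
Qed.

(** Li and Mathias' argument. The matrix [D] is the positive part of [S + G - c].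
    Both [- S] and [G - c] lie below [D - S], so each [s_j + g_j - c], and also [0],
    is at most [tau_j + s_j] with [tau] the sorted spectrum of [D - S]; the sum of
    these bounds is the trace of [D]. *)
Lemma lidskii_hinge P s S Q g G U b :
  diagonalizes P s S -> diagonalizes Q g G -> diagonalizes U b (S + G) ->
  (forall i j : 'I_d, (i <= j)%N -> s 0 i <= s 0 j) ->
  (forall i j : 'I_d, (i <= j)%N -> g 0 j <= g 0 i) ->
  forall c, \sum_i Num.max (s 0 i + g 0 i - c) 0 <=
            \sum_i Num.max (b 0 i - c) 0.
Proof.
move=> hS hG hB su gd c.
pose p : 'rV[R]_d := \row_i Num.max (b 0 i - c) 0.
pose D := U^t* *m real_diag p *m U.
have hD : diagonalizes U p D by split; first exact: hB.1.
have p0 i : 0 <= p 0 i by rewrite mxE le_max lexx orbT.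
have sT : (D - S)^t* = D - S.
  by rewrite trmxCD trmxCN (diagonalizes_selfadj hD) (diagonalizes_selfadj hS).
have [V [tau [hT td]]] := selfadj_diag_down sT.
have le1 j : - s 0 j <= tau 0 j.
  have := weyl_monotonicity (diagonalizesN hS) hT _ td.
  move=> H; have := H _ _ j; rewrite mxE; apply=> [i k ik|x].
    by rewrite !mxE lerN2 su.
  by rewrite opprK subrK; apply: quad_ge0 hD p0.
have le2 j : g 0 j <= tau 0 j + c.
  have hTc := diagonalizesD hT (diagonalizes_scalar c hT.1).
  have := weyl_monotonicity hG hTc gd.
  move=> H; have := H _ _ j; rewrite !mxE; apply=> [i k ik|x].
    by rewrite !mxE lerD2r td.
  have -> : D - S + (c%:C)%:M - G = D + - (S + G) + (c%:C)%:M.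
    by rewrite opprD !addrA [RHS]addrAC.
  apply: (quad_ge0 _ (diagonalizesD (diagonalizesD hD (diagonalizesN hB))
    (diagonalizes_scalar c hB.1))) => i.
  rewrite !mxE; have : b 0 i - c <= Num.max (b 0 i - c) 0 by rewrite le_max lexx.
  lra.
have trT : \sum_i (tau 0 i + s 0 i) = \sum_i Num.max (b 0 i - c) 0.
  have -> : \sum_i Num.max (b 0 i - c) 0 = \sum_i p 0 i.
    by apply: eq_bigr => i _; rewrite mxE.
  apply: complexI; rewrite -(trace_diagonalizes hD) big_split rmorphD /=.
  by rewrite -(trace_diagonalizes hT) -(trace_diagonalizes hS) -mxtraceD subrK.
rewrite -trT; apply: ler_sum => j _.
rewrite ge_max; have := le1 j; have := le2 j; lra.
Qed.

Lemma lidskii_trace_inequality phi P s S Q g G U b :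
  strictly_convex_nneg phi ->
  diagonalizes P s S -> diagonalizes Q g G -> diagonalizes U b (S + G) ->
  (forall i j : 'I_d, (i <= j)%N -> s 0 i <= s 0 j) ->
  (forall i j : 'I_d, (i <= j)%N -> g 0 j <= g 0 i) ->
  (forall i, 0 <= s 0 i + g 0 i) -> (forall i, 0 <= b 0 i) ->
  \sum_i phi (s 0 i + g 0 i) <= \sum_i phi (b 0 i).
Proof.
move=> cvx hS hG hB su gd sg0 b0.
have sumE (F : R -> R) (f : 'I_d -> R) :
    \sum_(x <- [seq f i | i <- enum 'I_d]) F x = \sum_i F (f i).
  by rewrite big_map big_enum.
rewrite -(sumE _ (fun i => s 0 i + g 0 i)) -(sumE _ (b 0)).
apply: karamata => //.
- by rewrite !size_map.
- by move=> _ /mapP[i _ ->].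
- by move=> _ /mapP[i _ ->].
- rewrite !(sumE id); apply: complexI; rewrite -(trace_diagonalizes hB) mxtraceD.
  rewrite (trace_diagonalizes hS) (trace_diagonalizes hG) -rmorphD.
  by rewrite big_split.
- by move=> c; rewrite !(sumE (fun z => Num.max (z - c) 0)); exact: (lidskii_hinge hS hG hB su gd c).
Qed.

End HermitianMatrices.

Local Open Scope ring_scope.
Local Open Scope complex_scope.

Theorem theorem3p2 (R : realType) (d : nat) (S : 'M[R[i]]_d) (mu : 'rV[R]_d)
    (phi : R -> R) (G0 : 'M[R[i]]_d)
    (S_psd : psdmx S)
    (mu_noninc : forall i j : 'I_d, (i <= j)%N -> mu 0 j <= mu 0 i)
    (mu_ge0 : forall i : 'I_d, 0 <= mu 0 i)
    (phi_ge0 : forall x : R, 0 <= x -> 0 <= phi x)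
    (phi_convex : strictly_convex_nneg phi)
    (G0_locmin : local_minimizer_on (orbit_mu mu) (Phi phi S) G0) :
  (exists2 v : 'I_d -> 'cV[R[i]]_d,
     orthonormal_basis v &
     S = \sum_(i < d) (lambda_up S 0 i)%:C *: outer (v i) (v i) /\
     G0 = \sum_(i < d) (mu 0 i)%:C *: outer (v i) (v i)) /\
  lambda_down (S + G0) = rearr_down (lambda_up S + lambda_down G0) /\
  global_minimizer_on (orbit_mu mu) (Phi phi S) G0.
Proof.
have [P [hS hG su]] := local_min_codiagonal S_psd mu_noninc mu_ge0 phi_convex G0_locmin.
have outerE i : outer ((row i P)^t*)%sesqui ((row i P)^t*)%sesqui = ((row i P)^t* *m row i P)%sesqui.
  by rewrite /outer trmxCK.
have hSG := diagonalizesD hS hG.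
have lG := G0_locmin.1.2.
split; [|split].
- exists (fun i => ((row i P)^t*)%sesqui); first exact: orthonormal_basis_rows hS.1.
  split.
  + by rewrite {1}hS.2 diagonal_form_sum; apply: eq_bigr => i _; rewrite outerE.
  + by rewrite {1}hG.2 diagonal_form_sum; apply: eq_bigr => i _; rewrite outerE.
- by rewrite lG (lambda_down_rearr hSG).
- split; first exact: G0_locmin.1.
  move=> G OG.
  have [Q hQ] := (orbit_muP G mu_noninc mu_ge0).1 OG.
  have sS := (diagonalizes_selfadj hS).
  have sB : ((S + G)^t*)%sesqui = S + G by rewrite trmxCD sS (diagonalizes_selfadj hQ).
  have [U [b hB]] := selfadj_diag sB.
  rewrite (PhiE phi hSG) (PhiE phi hB).
  under eq_bigr do rewrite mxE.
  apply: (lidskii_trace_inequality phi_convex hS hQ hB) => //.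
  + by move=> i; rewrite Num.Theory.addr_ge0 // ((psdmx_diagonalizes hS).1 S_psd).
  + by apply/(psdmx_diagonalizes hB)/psdmxD; [exact: S_psd | exact: OG.1].
Qed.
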